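(* Let $\mathfrak q$ be a Leibniz algebra and $c\ge 1$. Then: (a) $\gamma_{c+1}^{\mathsf{Lie}^\ast}(\mathfrak q)=0$ if and only if $\mathfrak q$ is $\mathsf{Lie}$-nilpotent of class $c$ and $\mathcal M_{\mathsf{Lie}}^{(c)}(\mathfrak q)=0$. (b) If $\gamma_{c+1}^{\mathsf{Lie}^\ast}(\mathfrak q)=0$, then $\gamma_{c+1}^{\mathsf{Lie}^\ast}(\mathfrak q/\mathfrak n)=0$ for any two-sided ideal $\mathfrak n$ of $\mathfrak q$.
   Context: $\mathbb K$ is a field with $\frac12\in\mathbb K$. A Leibniz algebra is a $\mathbb K$-vector space with a bilinear bracket satisfying $[x,[y,z]]=[[x,y],z]-[[x,z],y]$. For two-sided ideals $\mathfrak m,\mathfrak n$ of $\mathfrak q$, $[\mathfrak m,\mathfrak n]_{\mathsf{Lie}}$ is the span of all $[m,n]+[n,m]$, $m\in\mathfrak m$, $n\in\mathfrak n$. For a two-sided ideal $\mathfrak n$ of $\mathfrak q$: $\gamma_1^{\mathsf{Lie}}(\mathfrak q,\mathfrak n)=\mathfrak n$, $\gamma_i^{\mathsf{Lie}}(\mathfrak q,\mathfrak n)=[\gamma_{i-1}^{\mathsf{Lie}}(\mathfrak q,\mathfrak n),\mathfrak q]_{\mathsf{Lie}}$ for $i\ge2$, and $\gamma_i^{\mathsf{Lie}}(\mathfrak q)=\gamma_i^{\mathsf{Lie}}(\mathfrak q,\mathfrak q)$. The Leibniz algebra $\mathfrak q$ is said to be $\mathsf{Lie}$-nilpotent of class $c$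 if $\gamma_{c+1}^{\mathsf{Lie}}(\mathfrak q)=0$ and $\gamma_c^{\mathsf{Lie}}(\mathfrak q)\neq0$. Let $0\to\mathfrak r\to\mathfrak f\xrightarrow{\rho}\mathfrak q\to0$ be a free presentation ($\mathfrak f$ a free Leibniz algebra, $\mathfrak r=\ker\rho$). Then $\gamma_{c+1}^{\mathsf{Lie}^\ast}(\mathfrak q)=\gamma_{c+1}^{\mathsf{Lie}}(\mathfrak f)/\gamma_{c+1}^{\mathsf{Lie}}(\mathfrak f,\mathfrak r)$, and the $c$-nilpotent Schur $\mathsf{Lie}$-multiplier is $\mathcal M_{\mathsf{Lie}}^{(c)}(\mathfrak q)=(\mathfrak r\cap\gamma_{c+1}^{\mathsf{Lie}}(\mathfrak f))/\gamma_{c+1}^{\mathsf{Lie}}(\mathfrak f,\mathfrak r)$; both are independent of the chosen free presentation.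
   Formalization: Part (a) fails literally for q = 0, c = 1, as γ_1(0) = 0. It is proved with ''Lie-nilpotent of class c'' replaced by γ_{c+1}^Lie(q) = 0 (class at most c), and with the exact class c under the added hypothesis γ_c^Lie(q) ≠ 0. *)

(* Defs.v *)
From HB Require Import structures.
From mathcomp Require Import all_boot all_order all_algebra ring_quotient.
From mathcomp Require Import boolp classical_sets.
Set Implicit Arguments.
Unset Strict Implicit.
Unset Printing Implicit Defensive.
Import GRing.Theory.
Local Open Scope classical_set_scope.
Local Open Scope ring_scope.
Local Open Scope quotient_scope.

(* (Right) Leibniz algebras over a field, of arbitrary dimension. *)
HB.mixin Record isLeibniz (K : fieldType) L of GRing.Lmodule K L := {
  bracket : L -> L -> L;
  bracket_linearl : forall y, linear (bracket^~ y);
  bracket_linearr : forall x, linear (bracket x);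
  bracket_leibniz : forall x y z,
    bracket x (bracket y z) = bracket (bracket x y) z - bracket (bracket x z) y
}.

#[short(type="leibnizType")]
HB.structure Definition Leibniz (K : fieldType) :=
  { L of isLeibniz K L & GRing.Lmodule K L }.

Record leibniz_hom (K : fieldType) (A B : leibnizType K) := LeibnizHom {
  hom_fun :> {linear A -> B};
  homB : forall x y, hom_fun (bracket x y) = bracket (hom_fun x) (hom_fun y)
}.

Record ideal (K : fieldType) (L : leibnizType K) := Ideal {
  ideal_set :> set L;
  ideal0 : ideal_set 0;
  idealD : forall x y, ideal_set x -> ideal_set y -> ideal_set (x + y);
  idealZ : forall (a : K) x, ideal_set x -> ideal_set (a *: x);
  ideal_bracketl : forall x y, ideal_set y -> ideal_set (bracket x y);
  ideal_bracketr : forall x y, ideal_set x -> ideal_set (bracket x y)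
}.

Section BracketTheory.
Variables (K : fieldType) (L : leibnizType K).
Implicit Types (x y z : L) (a : K).

Lemma bracketDl x y z : bracket (x + y) z = bracket x z + bracket y z.
Proof. by have := bracket_linearl z 1 x y; rewrite !scale1r. Qed.

Lemma bracketDr x y z : bracket x (y + z) = bracket x y + bracket x z.
Proof. by have := bracket_linearr x 1 y z; rewrite !scale1r. Qed.

Lemma bracket0l y : bracket (0 : L) y = 0.
Proof. by apply: (@addrI _ (bracket 0 y)); rewrite -bracketDl !addr0. Qed.

Lemma bracket0r x : bracket x (0 : L) = 0.
Proof. by apply: (@addrI _ (bracket x 0)); rewrite -bracketDr !addr0. Qed.

Lemma bracketZl a x y : bracket (a *: x) y = a *: bracket x y.
Proof. by have := bracket_linearl y a x 0; rewrite !addr0 bracket0l addr0. Qed.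

Lemma bracketZr a x y : bracket x (a *: y) = a *: bracket x y.
Proof. by have := bracket_linearr x a y 0; rewrite !addr0 bracket0r addr0. Qed.

Lemma bracketNl x y : bracket (- x) y = - bracket x y.
Proof. by rewrite -scaleN1r bracketZl scaleN1r. Qed.

Lemma bracketNr x y : bracket x (- y) = - bracket x y.
Proof. by rewrite -scaleN1r bracketZr scaleN1r. Qed.

Lemma bracket_sym_r x y z : bracket x (bracket y z + bracket z y) = 0.
Proof.
by rewrite bracketDr !bracket_leibniz addrA subrK subrr.
Qed.

Lemma bracket_sym_l x y z : bracket (bracket y z + bracket z y) x =
  (bracket y (bracket z x) + bracket (bracket z x) y) +
  (bracket (bracket y x) z + bracket z (bracket y x)).
Proof.
rewrite bracketDl !bracket_leibniz [_ - _ + _]addrAC [X in _ = X]addrA subrK.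
by rewrite [RHS]addrACA subrr addr0.
Qed.

End BracketTheory.

Definition span (K : fieldType) (V : lmodType K) (S : set V) : set V :=
  [set v | exists2 s : seq (K * V),
     forall p, p \in s -> S p.2 & v = \sum_(p <- s) p.1 *: p.2].

Section Ideals.
Variables (K : fieldType) (L : leibnizType K).

Lemma sub_span (S : set L) : S `<=` span S.
Proof.
move=> x Sx; exists [:: (1, x)]; last by rewrite big_seq1 scale1r.
by move=> p; rewrite inE => /eqP->.
Qed.

Lemma span0 (S : set L) : span S 0.
Proof. by exists [::]; rewrite ?big_nil. Qed.

Lemma spanD (S : set L) x y : span S x -> span S y -> span S (x + y).
Proof.
move=> [s sS ->] [t tS ->]; exists (s ++ t); last by rewrite big_cat.
by move=> p; rewrite mem_cat => /orP[/sS|/tS].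
Qed.

Lemma spanZ (S : set L) (a : K) x : span S x -> span S (a *: x).
Proof.
move=> [s sS ->]; exists [seq (a * p.1, p.2) | p <- s].
  by move=> _ /mapP[p /sS Sp ->].
by rewrite scaler_sumr big_map; apply: eq_bigr => p _; rewrite scalerA.
Qed.

Definition ideal_top : ideal L :=
  @Ideal K L setT I (fun _ _ _ _ => I) (fun _ _ _ => I) (fun _ _ _ => I)
    (fun _ _ _ => I).

Definition lie_comm_set (m n : set L) : set L :=
  span [set z | exists x y, [/\ m x, n y & z = bracket x y + bracket y x]].

Lemma lie_comm_bracketl (m n : set L) x y :
  lie_comm_set m n y -> lie_comm_set m n (bracket x y).
Proof.
move=> [s sS ->].
rewrite (_ : bracket x _ = 0); first exact: span0.
rewrite (big_morph (bracket x) (bracketDr x) (bracket0r x)) big_seq big1 // => p.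
by move=> /sS[u [v [_ _ ->]]]; rewrite bracketZr bracket_sym_r scaler0.
Qed.

Lemma lie_comm_bracketr (m n : ideal L) x y :
  lie_comm_set m n x -> lie_comm_set m n (bracket x y).
Proof.
move=> [s sS ->].
rewrite (big_morph (bracket^~ y) (fun u v => bracketDl u v y) (bracket0l y)).
rewrite big_seq; elim/big_ind: _ => [|u v|p /sS[u [v [mu nv ->]]]].
- exact: span0.
- exact: spanD.
rewrite bracketZl bracket_sym_l; apply: spanZ; apply: spanD; apply: sub_span.
  by exists u, (bracket v y); split => //; apply: ideal_bracketr.
by exists (bracket u y), v; split => //; apply: ideal_bracketr.
Qed.

(* [m, n]_Lie; it is again a two-sided ideal. *)
Definition lie_comm (m n : ideal L) : ideal L :=
  Ideal (span0 _) (@spanD _) (@spanZ _)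
    (@lie_comm_bracketl m n) (@lie_comm_bracketr m n).

(* gamma_i^Lie(L, n) for i >= 1; the value at i = 0 is junk (it is n). *)
Definition lie_gamma (n : ideal L) (i : nat) : ideal L :=
  iter i.-1 (fun m => lie_comm m ideal_top) n.

End Ideals.

Arguments ideal_top {K} L.

Section QuotientAlgebra.
Variables (K : fieldType) (L : leibnizType K) (n : ideal L).

Lemma idealN x : ideal_set n x -> ideal_set n (- x).
Proof. by rewrite -scaleN1r; apply: idealZ. Qed.

Definition ideal_pred : {pred L} := fun x => `[< ideal_set n x >].

Lemma ideal_pred_zmod : zmod_closed ideal_pred.
Proof.
split=> [|x y /asboolP nx /asboolP ny]; apply/asboolP; first exact: ideal0.
by apply: idealD => //; apply: idealN.
Qed.

HB.instance Definition _ := GRing.isZmodClosed.Build L ideal_pred ideal_pred_zmod.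

(* The quotient algebra L / n, and the canonical projection quot_pi below. *)
Definition quot := Quotient.quot ideal_pred.

HB.instance Definition _ := GRing.Zmodule.on quot.

Definition quot_proj (x : L) : quot := \pi_(Quotient.quot ideal_pred) x.
Definition quot_repr (u : quot) : L :=
  repr (u : Quotient.quot ideal_pred).

Lemma quot_reprK : cancel quot_repr quot_proj.
Proof. exact: reprK. Qed.

Lemma quot_projP x y : quot_proj x = quot_proj y <-> ideal_set n (x - y).
Proof.
split=> [/eqP|nxy]; last apply/eqP; rewrite /quot_proj -Quotient.idealrBE.
  by move/asboolP.
exact/asboolP.
Qed.

Lemma quot_projD x y : quot_proj (x + y) = quot_proj x + quot_proj y.
Proof. exact: raddfD. Qed.

Definition quot_scale (a : K) (u : quot) : quot := quot_proj (a *: quot_repr u).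

Lemma quot_projZ a x : quot_proj (a *: x) = quot_scale a (quot_proj x).
Proof.
apply/quot_projP; rewrite -scalerBr; apply: idealZ.
by apply/quot_projP; rewrite quot_reprK.
Qed.

Lemma quot_ind (P : quot -> Prop) : (forall x, P (quot_proj x)) -> forall u, P u.
Proof. by move=> Px u; rewrite -[u]quot_reprK. Qed.

Lemma quot_scaleA a b u : quot_scale a (quot_scale b u) = quot_scale (a * b) u.
Proof. by elim/quot_ind: u => x; rewrite -!quot_projZ scalerA. Qed.

Lemma quot_scale1 : left_id 1 quot_scale.
Proof. by elim/quot_ind=> x; rewrite -quot_projZ scale1r. Qed.

Lemma quot_scaleDr : right_distributive quot_scale +%R.
Proof.
move=> a; elim/quot_ind=> x; elim/quot_ind=> y.
by rewrite -quot_projD -!quot_projZ scalerDr quot_projD.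
Qed.

Lemma quot_scaleDl u : {morph quot_scale^~ u : a b / a + b}.
Proof.
move=> a b; elim/quot_ind: u => x.
by rewrite -!quot_projZ scalerDl quot_projD.
Qed.

HB.instance Definition _ := GRing.Zmodule_isLmodule.Build K quot
  quot_scaleA quot_scale1 quot_scaleDr quot_scaleDl.

Definition quot_bracket (u v : quot) : quot :=
  quot_proj (bracket (quot_repr u) (quot_repr v)).

Lemma quot_projB x y :
  quot_proj (bracket x y) = quot_bracket (quot_proj x) (quot_proj y).
Proof.
set x' := quot_repr (quot_proj x); set y' := quot_repr (quot_proj y).
have nx : ideal_set n (x - x') by apply/quot_projP; rewrite quot_reprK.
have ny : ideal_set n (y - y') by apply/quot_projP; rewrite quot_reprK.
apply/quot_projP.
have -> : bracket x y - bracket x' y' = bracket (x - x') y + bracket x' (y - y').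
  by rewrite bracketDl bracketDr bracketNl bracketNr addrA subrK.
by apply: idealD; [apply: ideal_bracketr | apply: ideal_bracketl].
Qed.

Lemma quot_bracket_linearl v : linear (quot_bracket^~ v).
Proof.
move=> a; elim/quot_ind=> x; elim/quot_ind=> y; elim/quot_ind: v => z.
have quotZ w : a *: quot_proj w = quot_proj (a *: w) by rewrite quot_projZ.
by rewrite quotZ -quot_projD -!quot_projB quotZ -quot_projD bracketDl bracketZl.
Qed.

Lemma quot_bracket_linearr u : linear (quot_bracket u).
Proof.
move=> a; elim/quot_ind=> x; elim/quot_ind=> y; elim/quot_ind: u => z.
have quotZ w : a *: quot_proj w = quot_proj (a *: w) by rewrite quot_projZ.
by rewrite quotZ -quot_projD -!quot_projB quotZ -quot_projD bracketDr bracketZr.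
Qed.

Lemma quot_bracket_leibniz u v w :
  quot_bracket u (quot_bracket v w) =
  quot_bracket (quot_bracket u v) w - quot_bracket (quot_bracket u w) v.
Proof.
elim/quot_ind: u => x; elim/quot_ind: v => y; elim/quot_ind: w => z.
have quotN t : - quot_proj t = quot_proj (- t) by rewrite /quot_proj raddfN.
by rewrite -!quot_projB quotN -quot_projD bracket_leibniz.
Qed.

HB.instance Definition _ := isLeibniz.Build K quot
  quot_bracket_linearl quot_bracket_linearr quot_bracket_leibniz.

Lemma quot_proj_linear : linear quot_proj.
Proof. by move=> a x y; rewrite quot_projD quot_projZ. Qed.

HB.instance Definition _ := GRing.isLinear.Build K L quot _ quot_proj
  quot_proj_linear.

Definition quot_pi : leibniz_hom L quot :=
  @LeibnizHom K L quot quot_proj quot_projB.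

End QuotientAlgebra.

Section Kernel.
Variables (K : fieldType) (A B : leibnizType K) (h : leibniz_hom A B).

Let ker_set : set A := [set x | h x = 0].

Lemma ker0 : ker_set 0. Proof. exact: raddf0. Qed.

Lemma kerD x y : ker_set x -> ker_set y -> ker_set (x + y).
Proof. by move=> hx hy; rewrite /ker_set /= raddfD /= hx hy addr0. Qed.

Lemma kerZ (a : K) x : ker_set x -> ker_set (a *: x).
Proof. by move=> hx; rewrite /ker_set /= linearZ /= hx scaler0. Qed.

Lemma ker_bracketl x y : ker_set y -> ker_set (bracket x y).
Proof. by move=> hy; rewrite /ker_set /= homB hy bracket0r. Qed.

Lemma ker_bracketr x y : ker_set x -> ker_set (bracket x y).
Proof. by move=> hx; rewrite /ker_set /= homB hx bracket0l. Qed.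

Definition hom_ker : ideal A :=
  Ideal ker0 kerD kerZ ker_bracketl ker_bracketr.

End Kernel.

Definition is_free_leibniz (K : fieldType) (F : leibnizType K) : Prop :=
  exists (X : Type) (i : X -> F), forall (A : leibnizType K) (g : X -> A),
    exists h : leibniz_hom F A, (forall x, h (i x) = g x) /\
      forall h' : leibniz_hom F A, (forall x, h' (i x) = g x) -> h' =1 h.

Definition free_presentation (K : fieldType) (f q : leibnizType K)
    (rho : leibniz_hom f q) : Prop :=
  is_free_leibniz f /\ forall y, exists x, rho x = y.

Definition lie_nilpotent_of_class (K : fieldType) (q : leibnizType K) (c : nat) :=
  lie_gamma (ideal_top q) c.+1 = [set 0] :> set q /\
  lie_gamma (ideal_top q) c <> [set 0] :> set q.

Section Presentation.
Variables (K : fieldType) (f q : leibnizType K) (rho : leibniz_hom f q).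
Let r : ideal f := hom_ker rho.

(* As gamma_i^Lie(f, r) is contained in r and in gamma_i^Lie(f), the two
   quotients below are the images of their numerators in the quotient algebra
   f / gamma_i^Lie(f, r). *)

(* gamma_i^Lie*(q) *)
Definition lie_gamma_star (i : nat) : set (quot (lie_gamma r i)) :=
  quot_pi (lie_gamma r i) @` lie_gamma (ideal_top f) i.

(* the c-nilpotent Schur Lie-multiplier of q *)
Definition schur_lie_mult (c : nat) : set (quot (lie_gamma r c.+1)) :=
  quot_pi (lie_gamma r c.+1) @` (r `&` lie_gamma (ideal_top f) c.+1).

End Presentation.

Arguments lie_gamma_star {K f q} rho i _.
Arguments schur_lie_mult {K f q} rho c _.

(* Main.v *)
(* With r = ker rho, gamma_i^Lie*(q) = 0 says gamma_i(f) <= gamma_i(f, r), and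
   (a) follows by mapping gamma_i(f) onto gamma_i(q).  For (b), a free Leibniz
   algebra on a vector space V is the tensor space T(V)^+ with [a, v] = a (x) v
   for v in V, and gamma_{i+1} is gamma_i (x) V for i >= 2; stripping the last
   letter turns gamma_{i+1}(f) <= gamma_{i+1}(f, r) into the same inclusion for
   i, and hence for 2 by descent.  The inclusion in degree 2 does not depend on
   the free presentation and passes to larger r, since the symmetrised bracket
   <a, b> = [a, b] + [b, a] changes only by elements of [r, f]_Lie when a and b
   change by elements of r; bracketing with f then gives back all higher
   degrees. *)
Require Import Defs.
From HB Require Import structures.
From mathcomp Require Import all_boot all_order all_algebra.
From mathcomp Require Import boolp classical_sets functions.
Set Implicit Arguments.
Unset Strict Implicit.
Unset Printing Implicit Defensive.
Import GRing.Theory.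
Local Open Scope classical_set_scope.
Local Open Scope ring_scope.

(** * Linear endomorphisms as a vector space *)

Section Endo.
Variables (K : fieldType) (V : lmodType K).

Definition endo_pred : {pred V -> V} := fun g => `[< linear g >].

Lemma endo_pred_submod : submod_closed endo_pred.
Proof.
split=> [|a g h /asboolP lg /asboolP lh]; apply/asboolP => b x y.
  by change (0 = b *: 0 + 0 :> V); rewrite scaler0 addr0.
change (a *: g (b *: x + y) + h (b *: x + y) =
        b *: (a *: g x + h x) + (a *: g y + h y)).
by rewrite lg lh !scalerDr !scalerA addrACA [a * b]mulrC.
Qed.

HB.instance Definition _ :=
  GRing.isSubmodClosed.Build K (V -> V) endo_pred endo_pred_submod.

Record endo := Endo { endo_fun :> V -> V; _ : endo_fun \in endo_pred }.

HB.instance Definition _ := [isSub for endo_fun].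
HB.instance Definition _ := [Choice of endo by <:].
HB.instance Definition _ := [SubChoice_isSubLmodule of endo by <:].

Lemma endo_linear (g : endo) : linear g.
Proof. by case: g => g lg; apply/asboolP. Qed.

HB.instance Definition _ (g : endo) :=
  GRing.isLinear.Build K V V *:%R (endo_fun g) (endo_linear g).

Definition endo_of (g : V -> V) (lg : linear g) : endo := @Endo g (asboolT lg).

Lemma endoP (g h : endo) : (forall x, g x = h x) -> g = h.
Proof. by move=> gh; apply/val_inj/funext. Qed.

End Endo.

(** * An extension algebra recording the last letter *)

Section LastLetter.
Variables (K : fieldType) (Q : leibnizType K).

(* Makes "strip the last letter" accessible from the universal property alone:
   the homomorphism from a free algebra to ext extending i x |-> (0, i x, id)
   sends z to (D z, z, psi_z) with D [a, z] = psi_z a, so that D [a, i x] = a.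
   In T(V), psi_z a is a z with its last letter erased, z acting on the right
   as a Lie element; the third component of ext_bracket is what
   [m, [u, v]] = [[m, u], v] - [[m, v], u] imposes on psi. *)
Definition ext : Type := (Q * Q * endo Q)%type.
HB.instance Definition _ := GRing.Lmodule.on ext.

Definition ext_endo (u v : ext) (m : Q) : Q :=
  v.2 (bracket m u.1.2) - u.2 (bracket m v.1.2).

Lemma ext_endo_linear u v : linear (ext_endo u v).
Proof.
move=> a x y; rewrite /ext_endo !bracketDl !bracketZl !linearP /=.
by rewrite scalerDr addrACA.
Qed.

Definition ext_bracket (u v : ext) : ext :=
  (v.2 u.1.2, bracket u.1.2 v.1.2, endo_of (ext_endo_linear u v)).

Lemma extP (u v : ext) : u.1.1 = v.1.1 -> u.1.2 = v.1.2 ->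
  (forall m, u.2 m = v.2 m) -> u = v.
Proof.
by case: u v => [[a b] g] [[a' b'] g'] /= -> -> /endoP ->.
Qed.

Lemma ext_addE (u v : ext) m : (u + v).2 m = u.2 m + v.2 m.
Proof. by []. Qed.

Lemma ext_oppE (u : ext) m : (- u).2 m = - u.2 m.
Proof. by []. Qed.

Lemma ext_scaleE a (u : ext) m : (a *: u).2 m = a *: u.2 m.
Proof. by []. Qed.

Lemma ext_bracketE u v m : (ext_bracket u v).2 m =
  v.2 (bracket m u.1.2) - u.2 (bracket m v.1.2).
Proof. by []. Qed.

Definition extE := (ext_addE, ext_oppE, ext_scaleE, ext_bracketE).

Lemma ext_bracket_linearl v : linear (ext_bracket^~ v).
Proof.
move=> a x y; apply: extP => [||m].
- by rewrite /= linearP.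
- by rewrite /= bracketDl bracketZl.
rewrite !extE /= bracketDr bracketZr linearP.
by rewrite scalerBr opprD addrACA.
Qed.

Lemma ext_bracket_linearr u : linear (ext_bracket u).
Proof.
move=> a x y; apply: extP => [||m]; first by [].
- by rewrite /= bracketDr bracketZr.
rewrite !extE /= bracketDr bracketZr linearP.
by rewrite scalerBr opprD addrACA.
Qed.

Lemma ext_bracket_leibniz u v w :
  ext_bracket u (ext_bracket v w) =
  ext_bracket (ext_bracket u v) w - ext_bracket (ext_bracket u w) v.
Proof.
apply: extP => [||m].
- by [].
- exact: bracket_leibniz.
rewrite !extE /= !bracket_leibniz !linearB /= !opprK.
(* The left side is A - B - C + D; on the right E and F also occur, each with both signs. *)
set A := w.2 _; set B := v.2 _; set C := u.2 _; set D := u.2 _.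
set E := w.2 _; set F := v.2 _.
rewrite [RHS]addrACA [A - E + _]addrACA [- F + D + _]addrACA -addrA.
rewrite [- E + F + _]addrA -[- F + E]opprK opprD opprK [- E + F]addrC.
by rewrite subrr add0r [D - C]addrC.
Qed.

HB.instance Definition _ := isLeibniz.Build K ext
  ext_bracket_linearl ext_bracket_linearr ext_bracket_leibniz.

Definition ext_out (u : ext) : Q := u.1.1.
Definition ext_in (u : ext) : Q := u.1.2.

Lemma ext_out_linear : linear ext_out.
Proof. by []. Qed.

Lemma ext_in_linear : linear ext_in.
Proof. by []. Qed.

HB.instance Definition _ :=
  GRing.isLinear.Build K ext Q *:%R ext_out ext_out_linear.
HB.instance Definition _ :=
  GRing.isLinear.Build K ext Q *:%R ext_in ext_in_linear.

Definition ext_proj : leibniz_hom ext Q :=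
  @LeibnizHom K ext Q ext_in (fun _ _ => erefl).

Lemma idfun_linear : linear (@idfun Q).
Proof. by []. Qed.

Definition ext_letter (x : Q) : ext := (0, x, endo_of idfun_linear).

End LastLetter.

(** * Homomorphisms of Leibniz algebras *)

Section Homs.
Variable K : fieldType.
Implicit Types A B C : leibnizType K.

Section Comp.
Variables (A B C : leibnizType K) (g : leibniz_hom B C) (h : leibniz_hom A B).

Lemma hom_comp_bracket x y :
  g (h (bracket x y)) = bracket (g (h x)) (g (h y)).
Proof. by rewrite !homB. Qed.

Definition hom_comp : leibniz_hom A C :=
  @LeibnizHom K A C (g \o h) hom_comp_bracket.
End Comp.

Definition hom_id A : leibniz_hom A A :=
  @LeibnizHom K A A idfun (fun _ _ => erefl).

Lemma zero_hom_bracket A B (x y : A) :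
  let z : {linear A -> B} := \0 in z (bracket x y) = bracket (z x) (z y).
Proof. by rewrite /= bracket0l. Qed.

Definition hom_zero A B : leibniz_hom A B :=
  @LeibnizHom K A B (\0 : {linear A -> B}) (@zero_hom_bracket A B).

End Homs.

Lemma quot_pi_eq0 (K : fieldType) (A : leibnizType K) (n : ideal A) x :
  quot_pi n x = 0 <-> ideal_set n x.
Proof. by rewrite -(linear0 (quot_pi n)) quot_projP subr0. Qed.

(** * Consequences of freeness *)

Section Free.
Variables (K : fieldType) (f : leibnizType K).
Hypothesis free_f : is_free_leibniz f.

(** Projectivity: generators are lifted through a section of [p], and uniqueness identifies [p \o h]
    with [g]. *)
Lemma free_lift (A B : leibnizType K) (p : leibniz_hom A B)
    (g : leibniz_hom f B) :
  (forall y, exists x, p x = y) -> exists h : leibniz_hom f A, p \o h =1 g.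
Proof.
case: free_f => X [i univ] p_surj.
have [s sK] := choice p_surj.
have [h [hi _]] := univ A (fun x => s (g (i x))).
exists h; have [k [_ kuniq]] := univ B (fun x => g (i x)).
have pk : hom_comp p h =1 k by apply: kuniq => x; rewrite /= hi sK.
by move=> x; rewrite (kuniq g) // -pk.
Qed.

(* D is "strip the last letter, then reduce modulo B". *)
Lemma free_strip_last (B : ideal f) :
  (forall x : f, x = 0) \/
  exists2 D : {linear f -> quot B},
    exists e, forall a, D (bracket a e) = quot_pi B a &
    forall b z, ideal_set B b -> D (bracket b z) = 0.
Proof.
case: free_f => X [i univ].
case: (pselect (inhabited X)) => [[x0]|noX]; [right|left=> x]; last first.
  (* Without generators, zero and the identity extend the same empty map, so they coincide. *)
  have [h [_ huniq]] := univ f (fun=> 0).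
  have emp (y : X) : False by apply: noX; exists.
  have h0 := huniq (hom_zero f f) (fun y => False_ind _ (emp y)) x.
  have h1 := huniq (hom_id f) (fun y => False_ind _ (emp y)) x.
  by move: h0; rewrite -h1 /= => <-.
pose Q : leibnizType K := quot B; pose p : leibniz_hom f Q := quot_pi B.
have [h [hi _]] := univ (ext Q) (fun x => ext_letter (p (i x))).
have hE : hom_comp (ext_proj Q) h =1 p.
  have [k [_ kuniq]] := univ Q (fun x => p (i x)) => x.
  rewrite (kuniq p) //; apply: kuniq => y.
  by rewrite /= hi.
exists (@ext_out K Q \o h).
  (* Any generator serves as e: the third coordinate of its image is the identity. *)
  exists (i x0) => a; rewrite /= homB /= /ext_out /= hi /=.
  exact: (hE a).
move=> b z Bb; rewrite /= homB /= /ext_out /=.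
rewrite [(h b).1.2](hE b).
by have /quot_pi_eq0 -> := Bb; rewrite linear0.
Qed.
End Free.

(** * Lie-commutators and the series they generate *)

Section Gamma.
Variable K : fieldType.
Implicit Types A B : leibnizType K.

Lemma span_ind (V : lmodType K) (S P : set V) :
  P 0 -> (forall x y, P x -> P y -> P (x + y)) ->
  (forall (a : K) x, P x -> P (a *: x)) -> S `<=` P -> Defs.span S `<=` P.
Proof.
move=> P0 PD PZ SP _ [s sS ->]; rewrite big_seq.
by elim/big_ind: _ => // p /sS /SP; apply: PZ.
Qed.

Lemma span_ideal A (S : set A) (n : ideal A) : S `<=` n -> Defs.span S `<=` n.
Proof.
by apply: span_ind; [apply: ideal0|apply: idealD|apply: idealZ].
Qed.

Lemma lie_comm_mem A (m n : ideal A) x y : ideal_set m x -> ideal_set n y ->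
  ideal_set (lie_comm m n) (bracket x y + bracket y x).
Proof. by move=> mx ny; apply: Defs.sub_span; exists x, y. Qed.

Lemma lie_comm_image A B (h : leibniz_hom A B) (m n : ideal A) (m' n' : ideal B) :
  m `<=` h @^-1` m' -> n `<=` h @^-1` n' ->
  lie_comm m n `<=` h @^-1` lie_comm m' n'.
Proof.
move=> mm nn.
apply: (span_ind (P := fun u => ideal_set (lie_comm m' n') (h u)))
  => [|x y|a x|_ [x [y [mx ny ->]]]].
- by rewrite linear0; apply: ideal0.
- by rewrite linearD; apply: idealD.
- by rewrite linearZ; apply: idealZ.
- by rewrite linearD !homB; apply: lie_comm_mem; [apply: mm|apply: nn].
Qed.

Lemma lie_commS A (m n m' n' : ideal A) :
  m `<=` m' -> n `<=` n' -> lie_comm m n `<=` lie_comm m' n'.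
Proof. exact: (lie_comm_image (h := hom_id A)). Qed.

Lemma lie_comm_subl A (m : ideal A) (n : ideal A) : lie_comm m n `<=` m.
Proof.
apply: span_ideal => _ [x [y [mx _ ->]]].
by apply: idealD; [apply: ideal_bracketr|apply: ideal_bracketl].
Qed.

(** By the Leibniz identity [x, [u, v]] = -[x, [v, u]], so right multiplication by a symmetrised
    bracket vanishes. *)
Lemma bracket_lie_comm A (m n : ideal A) x y :
  ideal_set (lie_comm m n) y -> bracket x y = 0.
Proof.
move: y; apply: (span_ind (P := fun y => bracket x y = 0)) => [|u v|a u|].
- exact: bracket0r.
- by rewrite bracketDr => -> ->; rewrite addr0.
- by rewrite bracketZr => ->; rewrite scaler0.
- by move=> _ [u [v [_ _ ->]]]; apply: bracket_sym_r.
Qed.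

(** Indices start at 1 and the value at 0 is junk, so the recursion holds only from [i.+1] on. *)
Lemma lie_gammaS A (n : ideal A) i :
  lie_gamma n i.+2 = lie_comm (lie_gamma n i.+1) (ideal_top A).
Proof. by []. Qed.

Lemma lie_gamma_image A B (h : leibniz_hom A B) (m : ideal A) (n : ideal B) i :
  m `<=` h @^-1` n -> lie_gamma m i `<=` h @^-1` lie_gamma n i.
Proof.
move=> mn; case: i => // i; elim: i => // i IH.
by rewrite !lie_gammaS; apply: lie_comm_image.
Qed.

Lemma lie_gamma_sub A (n : ideal A) i : lie_gamma n i `<=` n.
Proof.
case: i => // i; elim: i => // i IH.
by rewrite lie_gammaS; apply: subset_trans IH; apply: lie_comm_subl.
Qed.

(** A symmetrised bracket lifts to the symmetrised bracket of lifts of its entries. *)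
Lemma lie_gamma_top_surj A B (h : leibniz_hom A B) i :
  (forall y, exists x, h x = y) ->
  lie_gamma (ideal_top B) i `<=` h @` lie_gamma (ideal_top A) i.
Proof.
move=> h_surj; case: i => [y _|]; first by have [x] := h_surj y; exists x.
elim=> [y _|i IH]; first by have [x] := h_surj y; exists x.
rewrite lie_gammaS.
apply: span_ind => [|_ _ [x gx <-] [y gy <-]|a _ [x gx <-]|].
- by exists 0; [apply: ideal0 | rewrite linear0].
- by exists (x + y); [apply: idealD | rewrite linearD].
- by exists (a *: x); [apply: idealZ | rewrite linearZ].
move=> _ [_ [y [/IH[x gx <-] _ ->]]]; have [z <-] := h_surj y.
exists (bracket x z + bracket z x); last by rewrite linearD !homB.
by rewrite lie_gammaS; apply: lie_comm_mem.
Qed.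

(** * Vanishing of quotients translated into inclusions of ideals *)

Lemma quot_pi_image_eq0 A (n : ideal A) (S : set A) : S 0 ->
  quot_pi n @` S = [set 0] <-> S `<=` n.
Proof.
move=> S0; split=> [E x Sx|Sn].
  have : (quot_pi n @` S) (quot_pi n x) by exists x.
  by rewrite E => /quot_pi_eq0.
apply/seteqP; split=> [_ [x /Sn nx <-]|_ ->]; first exact/quot_pi_eq0.
by exists 0 => //; rewrite linear0.
Qed.

Lemma lie_gamma_star_eq0 A B (h : leibniz_hom A B) i :
  lie_gamma_star h i = [set 0] <->
  lie_gamma (ideal_top A) i `<=` lie_gamma (hom_ker h) i.
Proof. by apply: quot_pi_image_eq0; apply: ideal0. Qed.

Lemma schur_lie_mult_eq0 A B (h : leibniz_hom A B) c :
  schur_lie_mult h c = [set 0] <->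
  hom_ker h `&` lie_gamma (ideal_top A) c.+1 `<=` lie_gamma (hom_ker h) c.+1.
Proof. by apply: quot_pi_image_eq0; split; apply: ideal0. Qed.

Lemma lie_gamma_top_eq0 A B (h : leibniz_hom A B) i :
  (forall y, exists x, h x = y) ->
  lie_gamma (ideal_top B) i = [set 0] :> set B <->
  lie_gamma (ideal_top A) i `<=` hom_ker h.
Proof.
move=> h_surj; split=> [E x gx|gh].
  have : ideal_set (lie_gamma (ideal_top B) i) (h x).
    have top_sub : ideal_top A `<=` h @^-1` ideal_top B by [].
    exact: (lie_gamma_image (i := i) top_sub gx).
  by rewrite E.
apply/seteqP; split=> [_ /(lie_gamma_top_surj h_surj)[x /gh kx <-]|_ ->] //.
exact: ideal0.
Qed.

(* In degree at least 2 the Lie-commutator with f is right multiplication by f,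
   because [f, gamma_i] = 0. *)
Lemma free_lie_gamma_descent A (r : ideal A) i : is_free_leibniz A ->
  lie_gamma (ideal_top A) i.+3 `<=` lie_gamma r i.+3 ->
  lie_gamma (ideal_top A) i.+2 `<=` lie_gamma r i.+2.
Proof.
move=> free_A; rewrite !(lie_gammaS _ i.+1) => sub a ga.
case: (free_strip_last free_A (lie_gamma r i.+2)) => [z|[D [e De] DB]].
  by rewrite (z a); apply: ideal0.
(* On a spanning element [b, z] + [z, b] the second term is zero, and D [b, z] = 0 because b lies in
   the ideal used as modulus. *)
have D0 : lie_comm (lie_gamma r i.+2) (ideal_top A) `<=` [set x | D x = 0].
  apply: span_ind => [|x y /= + +|c x /= +|_ [b [z [gb _ ->]]]] /=.
  - exact: linear0.
  - by rewrite linearD => -> ->; rewrite addr0.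
  - by rewrite linearZ /= => ->; rewrite scaler0.
  - by rewrite (bracket_lie_comm z gb) addr0 DB.
(* As [e, a] = 0, [a, e] is a symmetrised bracket; D kills it by [sub], yet returns the class of
   a. *)
apply/quot_pi_eq0; rewrite -De; apply: D0; apply: sub.
rewrite -[X in ideal_set _ X]addr0 -(bracket_lie_comm e ga).
exact: lie_comm_mem.
Qed.

(* <a, b> - <t a, t b> = <a - t a, b> + <b - t b, t a>
   for the symmetrised bracket <x, y> = [x, y] + [y, x]. *)
Lemma lie_gamma2_transfer A B C (p : leibniz_hom A C) (p' : leibniz_hom B C)
    (r : ideal A) :
  is_free_leibniz A -> is_free_leibniz B ->
  (forall y, exists x, p x = y) -> (forall y, exists x, p' x = y) ->
  r `<=` hom_ker p ->
  lie_gamma (ideal_top A) 2 `<=` lie_gamma r 2 ->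
  lie_gamma (ideal_top B) 2 `<=` lie_gamma (hom_ker p') 2.
Proof.
move=> free_A free_B p_surj p'_surj rp sub.
(* The map t is [k \o h], an endomorphism of B inducing the identity on C. *)
have [k pk] := free_lift free_A p p'_surj.
have [h ph] := free_lift free_B p' p_surj.
apply: span_ideal => _ [a [b [_ _ ->]]].
have ker_sub x : ideal_set (hom_ker p') (x - k (h x)).
  rewrite /= linearB; have := pk (h x); have := ph x => /= -> ->.
  by rewrite subrr.
have kr : r `<=` k @^-1` hom_ker p'.
  by move=> x rx; have := pk x; rewrite /= => ->; apply: rp.
(* <h a, h b> lies in gamma_2(A), hence in gamma_2(A, r), and [k] maps r into the kernel of [p']. *)
have gt : ideal_set (lie_gamma (hom_ker p') 2)
    (bracket (k (h a)) (k (h b)) + bracket (k (h b)) (k (h a))).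
  rewrite -!homB -!linearD; apply: (lie_gamma_image (i := 2) kr).
  by apply: sub; rewrite linearD !homB; apply: (lie_comm_mem (n := ideal_top A)).
set a' := k (h a) in gt *; set b' := k (h b) in gt *.
have -> : bracket a b = bracket (a - a') b + bracket a' (b - b') + bracket a' b'.
  by rewrite -addrA -bracketDr subrK -bracketDl subrK.
have -> : bracket b a = bracket b (a - a') + bracket (b - b') a' + bracket b' a'.
  by rewrite -addrA -bracketDl subrK -bracketDr subrK.
rewrite addrACA [X in X + _]addrACA [bracket a' (b - b') + _]addrC.
apply: idealD => //; apply: idealD.
- exact: (lie_comm_mem (n := ideal_top B) (ker_sub a)).
- exact: (lie_comm_mem (n := ideal_top B) (ker_sub b)).
Qed.

End Gamma.

Unset Implicit Arguments.
Set Strict Implicit.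
Set Printing Implicit Defensive.
Theorem proposition3p7 (K : fieldType) (two_neq0 : (2%:R : K) != 0)
    (f q : leibnizType K) (rho : leibniz_hom f q)
    (pres : free_presentation rho) (c : nat) (c_ge1 : (1 <= c)%N) :
  [/\ lie_gamma_star rho c.+1 = [set 0] <->
        (lie_gamma (ideal_top q) c.+1 = [set 0] :> set q /\
         schur_lie_mult rho c = [set 0]),
      lie_gamma (ideal_top q) c <> [set 0] :> set q ->
        (lie_gamma_star rho c.+1 = [set 0] <->
         (lie_nilpotent_of_class q c /\ schur_lie_mult rho c = [set 0])) &
      lie_gamma_star rho c.+1 = [set 0] ->
        forall (n : ideal q) (f' : leibnizType K)
          (rho' : leibniz_hom f' (quot n)),
          free_presentation rho' -> lie_gamma_star rho' c.+1 = [set 0]].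
Proof.
case: pres => free_f rho_surj.
(* This treats class at most c; class exactly c also requires gamma_c(q) to be nonzero. *)
have main : lie_gamma_star rho c.+1 = [set 0] <->
    (lie_gamma (ideal_top q) c.+1 = [set 0] :> set q /\
     schur_lie_mult rho c = [set 0]).
  rewrite lie_gamma_star_eq0 schur_lie_mult_eq0 (lie_gamma_top_eq0 _ rho_surj).
  split=> [sub|[sub sch] x gx].
    split; last by move=> x [_ /sub].
    by apply: subset_trans sub _; apply: lie_gamma_sub.
  by apply: sch; split=> //; apply: sub.
split=> //.
  move=> nz; rewrite main; split=> [[z s]|[[z _] s]] //.
move/lie_gamma_star_eq0 => sub n f' rho' [free_f' rho'_surj].
(* As c is positive, the degree is at least 2, where the descent ends. *)
apply/lie_gamma_star_eq0; case: c c_ge1 sub {main} => // c _ sub.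
have sub2 : lie_gamma (ideal_top f) 2 `<=` lie_gamma (hom_ker rho) 2.
  by elim: c sub => // c IH /(free_lie_gamma_descent free_f).
have {}sub2 : lie_gamma (ideal_top f') 2 `<=` lie_gamma (hom_ker rho') 2.
  (* The composite f -> q -> q/n is onto and its kernel contains r. *)
  apply: (lie_gamma2_transfer (p := hom_comp (quot_pi n) rho)) sub2 => //.
    by elim/quot_ind => y; have [x <-] := rho_surj y; exists x.
  by move=> x /= ->; apply: linear0.
(* Commutators with f' raise the inclusion from degree 2 to the required degree. *)
elim: c {sub} => // c IH; rewrite !(lie_gammaS _ c.+1).
exact: lie_commS.
Qed.
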